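(* Let $X$ be a Banach space, let $Y$ be a subspace of $X$, and let $\kappa,\kappa'$ be cardinals with $\kappa'<\kappa$ and $\kappa$ infinite. Then: (1) If $X$ has the $\kappa'$-Daugavet property and $Y$ is a $\kappa$ almost isometric ideal in $X$, then $Y$ has the $\kappa'$-Daugavet property. (2) If $X$ has the $\kappa'$-perfect Daugavet property and $Y$ is a $\kappa$ isometric ideal in $X$, then $Y$ has the $\kappa'$-perfect Daugavet property.
   Context: All Banach spaces are real. $\operatorname{dens}(E)$ is the least cardinality of a subset of $E$ spanning a dense subspace of $E$ (so it is the dimension for finite-dimensional $E$). Let $Y$ be a subspace of $X$ and $\kappa$ an infinite cardinal. $Y$ is a $\kappa$ isometric ideal in $X$ if for every subspace $E$ of $X$ with $\operatorname{dens}(E)<\kappa$ there exists a linear isometry (into) $T:E\to Y$ with $T(e)=e$ for all $e\in E\cap Y$. $Y$ is a $\kappa$ almost isometric ideal in $X$ if for every subspace $E$ of $X$ with $\operatorname{dens}(E)<\kappa$ and every $\varepsilon>0$ there exists an $\varepsilon$-isometry $T:E\to Y$, i.e. a linear operator with $(1-\varepsilon)\|e\|\leq\|T(e)\|\leq(1+\varepsilon)\|e\|$ for all $e\in E$, such that $T(e)=e$ for all $e\in E\cap Y$. $B_X$ and $S_X$ denote the closed unit ball and unit sphere of $X$. A slice of $B_X$ is a nonempty intersection of $B_X$ with an open half-space, i.e. a set $\{x\in B_X: f(x)>\sup f(B_X)-\alpha\}$ with $f\in X^*$, $\alpha>0$. For a cardinal $\kappa$ (finite or infinite), $\{y_\alpha:\alpha<\kappa\}$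 denotes a set of cardinality at most $\kappa$. $X$ has the $\kappa$-Daugavet property if for every family $\{y_\alpha:\alpha<\kappa\}\subseteq S_X$, every slice $S$ of $B_X$ and every $\varepsilon>0$ there is $x\in S$ with $\|y_\alpha+x\|>2-\varepsilon$ for all $\alpha<\kappa$. $X$ has the $\kappa$-perfect Daugavet property if for every family $\{y_\alpha:\alpha<\kappa\}\subseteq S_X$ and every slice $S$ of $B_X$ there is $x\in S$ with $\|y_\alpha+x\|=2$ for all $\alpha<\kappa$. *)

(* Defs.v *)
From HB Require Import structures.
From mathcomp Require Import all_boot all_order all_algebra.
From mathcomp Require Import all_classical all_reals all_analysis.

Set Implicit Arguments.
Unset Strict Implicit.
Unset Printing Implicit Defensive.

Import Order.TTheory GRing.Theory Num.Theory.
Import numFieldNormedType.Exports.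

Local Open Scope classical_set_scope.
Local Open Scope ring_scope.
Local Open Scope card_scope.

(* A cardinal is represented by a type [K], standing for [#|[set: K]|]. *)
Definition card_lt (T U : Type) (A : set T) (B : set U) : Prop :=
  A #<= B /\ ~ (B #<= A).

(* A linear subspace is a [Y : submodClosed V]; [submod Y] is its carrier seen
   as a normed space of its own, with the norm inherited from [V]. *)
Record submod (R : realType) (V : normedModType R) (Y : submodClosed V) :=
  Submod { submod_val : V; submodP : submod_val \in Y }.

Section SubmodNormed.
Context (R : realType) (V : normedModType R) (Y : submodClosed V).

HB.instance Definition _ := [isSub for @submod_val R V Y].
HB.instance Definition _ := [Choice of submod Y by <:].
HB.instance Definition _ := [SubChoice_isSubLmodule of submod Y by <:].

Definition submod_norm (u : submod Y) : R := `|\val u|.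

Lemma submod_normD u v : submod_norm (u + v) <= submod_norm u + submod_norm v.
Proof. by rewrite /submod_norm raddfD ler_normD. Qed.

Lemma submod_normZ (a : R) u : submod_norm (a *: u) = `|a| * submod_norm u.
Proof. by rewrite /submod_norm linearZ normrZ. Qed.

Lemma submod_norm0_eq0 u : submod_norm u = 0 -> u = 0.
Proof. by move/normr0_eq0 => u0; apply: val_inj; rewrite u0 raddf0. Qed.

HB.instance Definition _ := Lmodule_isNormed.Build R (submod Y)
  submod_normD submod_normZ submod_norm0_eq0.

End SubmodNormed.

Section Density.
Context (R : realType) (V : normedModType R).

Definition lin_span (D : set V) : set V :=
  [set v | exists (n : nat) (a : 'I_n -> R) (x : 'I_n -> V),
     (forall i, D (x i)) /\ v = \sum_(i < n) a i *: x i].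

(* dens(V) is the cardinality of [D]. *)
Definition attains_dens (D : set V) : Prop :=
  dense (lin_span D) /\ forall A : set V, dense (lin_span A) -> D #<= A.

(* dens(V) < K *)
Definition dens_lt (K : Type) : Prop :=
  exists D : set V, attains_dens D /\ card_lt D [set: K].

End Density.

Section Ideals.
Context (R : realType) (X : normedModType R).

Definition isometric_ideal (K : Type) (Y : submodClosed X) : Prop :=
  forall E : submodClosed X, dens_lt (submod E) K ->
  exists T : {linear submod E -> submod Y},
    (forall e, `|T e| = `|e|) /\
    (forall e, \val e \in Y -> \val (T e) = \val e).

Definition almost_isometric_ideal (K : Type) (Y : submodClosed X) : Prop :=
  forall E : submodClosed X, dens_lt (submod E) K ->
  forall eps : R, 0 < eps ->
  exists T : {linear submod E -> submod Y},
    (forall e, (1 - eps) * `|e| <= `|T e| <= (1 + eps) * `|e|) /\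
    (forall e, \val e \in Y -> \val (T e) = \val e).

End Ideals.

Section Daugavet.
Context (R : realType) (V : normedModType R).

Definition unit_ball : set V := [set x | `|x| <= 1].
Definition unit_sphere : set V := [set x | `|x| = 1].

Definition slice (S : set V) : Prop :=
  exists (f : {linear V -> R^o}) (alpha : R),
    continuous f /\ 0 < alpha /\
    S = [set x | unit_ball x /\ sup (f @` unit_ball) - alpha < f x].

(* The families {y_alpha : alpha < K} are sets of cardinality at most K; they
   may be empty. *)
Definition Daugavet (K : Type) : Prop :=
  forall A : set V, A `<=` unit_sphere -> A #<= [set: K] ->
  forall S : set V, slice S -> forall eps : R, 0 < eps ->
  exists2 x, S x & forall y, A y -> 2 - eps < `|y + x|.

Definition perfect_Daugavet (K : Type) : Prop :=
  forall A : set V, A `<=` unit_sphere -> A #<= [set: K] ->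
  forall S : set V, slice S ->
  exists2 x, S x & forall y, A y -> `|y + x| = 2.

End Daugavet.

Arguments dens_lt {R} V K.
Arguments slice {R} V S.
Arguments Daugavet {R} V K.
Arguments perfect_Daugavet {R} V K.

(* Main.v *)
(* An ideal operator [T : E -> Y] need not respect a functional [f] on [Y], so a
   point of [X] witnessing the Daugavet property cannot be carried directly into
   the slice of [B_Y] defined by [f].  By Hahn-Banach, however, if every slice of
   [B_X] contains a point [x] with all [|y_alpha + x|] (almost) equal to 2, then
   every point of [B_X] is a limit of convex combinations of such points.  Pick
   [u] in [B_Y] with [f u] close to [sup f(B_Y)], approximate it by such a
   combination of [x_1, ..., x_n], and apply [T] to the span [E] of the [y_alpha],
   [u] and the [x_i], whose density character is less than [kappa].  As [T] fixes [u]
   and the [y_alpha], [u] is close to the same convex combination of the [T x_i],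
   so that one of the [T x_i] (normalized) lies in the slice.

   Hahn-Banach, in the form used, follows from Zorn's lemma: a minimal sublinear
   functional is linear. *)
Require Import Defs.
From HB Require Import structures.
From mathcomp Require Import all_boot all_order all_algebra.
From mathcomp Require Import all_classical all_reals all_analysis.
From mathcomp Require Import ring lra.

Set Implicit Arguments.
Unset Strict Implicit.
Unset Printing Implicit Defensive.

Import Order.TTheory GRing.Theory Num.Theory.
Import numFieldNormedType.Exports.

Local Open Scope classical_set_scope.
Local Open Scope ring_scope.
Local Open Scope card_scope.

(** * Sublinear functionals and the Hahn-Banach theorem *)

Section HahnBanach.
Context (R : realType) (V : lmodType R).

(** Homogeneity is asked only as an inequality, which is easier to check for infima; [sublinearZ]
    recovers the equality. *)
Definition sublinear (p : V -> R) : Prop :=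
  (forall u v, p (u + v) <= p u + p v) /\
  (forall (a : R) v, 0 <= a -> p (a *: v) <= a * p v).

Lemma sublinear_ge_opp p v : sublinear p -> - p (- v) <= p v.
Proof.
move=> [pD _].
have p0 : p 0 <= p 0 + p 0 by have := pD 0 0; rewrite addr0.
by have := pD v (- v); rewrite subrr => pvv; lra.
Qed.

Lemma sublinearZ p (a : R) v : sublinear p -> 0 <= a -> p (a *: v) = a * p v.
Proof.
move=> pS; have [_ pZ] := pS; rewrite le_eqVlt => /predU1P[<-|a0].
  rewrite scale0r mul0r; apply/eqP; rewrite eq_le.
  have := sublinear_ge_opp 0 pS; have := pZ 0 0 (lexx 0).
  by rewrite oppr0 scale0r mul0r => *; apply/andP; split; lra.
have a0' := ltW a0; apply/eqP; rewrite eq_le pZ//= -ler_pdivlMl//.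
have /(pZ _ (a *: v)) : 0 <= a^-1 by rewrite invr_ge0.
by rewrite scalerA mulVf ?scale1r// gt_eqF.
Qed.

Lemma has_inf_le (A : set R) r : has_inf A -> A r -> inf A <= r.
Proof. by move=> [_ Ab] Ar; exact: ge_inf. Qed.

(* [P] is read as a convex cone of pairs [(v, r)], whose lower envelope is the
   infimum. *)
Lemma inf_sublinear (P : V -> set R) :
  (forall v, has_inf (P v)) ->
  (forall u v r s, P u r -> P v s -> exists2 t, P (u + v) t & t <= r + s) ->
  (forall (a : R) v r, 0 <= a -> P v r -> exists2 t, P (a *: v) t & t <= a * r) ->
  sublinear (fun v => inf (P v)).
Proof.
move=> Pinf PD PZ; have leP v r : P v r -> inf (P v) <= r by exact: has_inf_le.
split=> [u v|a v a0].
  apply/ler_addgt0Pr => e e0; have e20 : 0 < e / 2 by rewrite divr_gt0.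
  have [r Pr rlt] := inf_adherent e20 (Pinf u).
  have [s Ps slt] := inf_adherent e20 (Pinf v).
  by have [t /leP tP tle] := PD _ _ _ _ Pr Ps; lra.
have [->|an0] := eqVneq a 0; last first.
  have agt0 : 0 < a by rewrite lt_neqAle eq_sym an0.
  rewrite mulrC -ler_pdivrMr//; apply: lb_le_inf; first by case: (Pinf v).
  move=> r Pr; have [t /leP tP tle] := PZ _ _ _ a0 Pr.
  by rewrite ler_pdivrMr// mulrC (le_trans tP).
have [[r Pr] _] := Pinf v.
by have [t /leP tP] := PZ 0 v r (lexx 0) Pr; rewrite !mul0r; exact: le_trans.
Qed.

(** Zorn's lemma on the sublinear functionals below [q], in reversed order: the pointwise infimum of
    a nonempty chain is again sublinear, and [- q (- v)] keeps it finite. *)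
Lemma minimal_sublinear (q : V -> R) : sublinear q ->
  exists p, [/\ sublinear p, forall v, p v <= q v &
    forall p', sublinear p' -> (forall v, p' v <= p v) -> p' = p].
Proof.
move=> qS; pose T := {p : V -> R | sublinear p /\ forall v, p v <= q v}.
pose mk p pS pq : T := exist _ p (conj pS pq).
pose r (s t : T) := `[< forall v, sval t v <= sval s v >].
have [||||[p [pS pq]] pmin] := @Zorn T r.
- by move=> t; apply/asboolP.
- move=> s t u /asboolP st /asboolP tu; apply/asboolP => v.
  exact: le_trans (tu v) (st v).
- move=> [s Ps] [t Pt] /asboolP/= st /asboolP/= ts; apply/eq_exist/funext => v.
  by apply/eqP; rewrite eq_le ts st.
- move=> A Atot; have [->|/set0P[t0 At0]] := eqVneq A set0.
    by exists (mk q qS (fun v => lexx (q v))).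
  pose P v := [set sval t v | t in A].
  have Pinf v : has_inf (P v).
    split; first by exists (sval t0 v), t0.
    exists (- q (- v)) => _ [[p [pS pq]] _ <-] /=.
    by apply: le_trans (sublinear_ge_opp _ pS); rewrite lerN2.
  have iS : sublinear (fun v => inf (P v)).
    apply: inf_sublinear => //.
      move=> u v _ _ [s As <-] [t At <-].
      have [[sD _] _] := svalP s; have [[tD _] _] := svalP t.
      have [/asboolP st|/asboolP ts] := Atot _ _ As At.
        exists (sval t (u + v)); first by exists t.
        by apply: le_trans (tD u v) _; rewrite lerD2r.
      exists (sval s (u + v)); first by exists s.
      by apply: le_trans (sD u v) _; rewrite lerD2l.
    move=> a v _ a0 [t At <-]; exists (sval t (a *: v)); first by exists t.
    by have [[_ tZ] _] := svalP t; exact: tZ.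
  have iq v : inf (P v) <= q v.
    apply: le_trans (has_inf_le (Pinf v) _) _; first by exists t0.
    by case: (svalP t0).
  exists (mk _ iS iq) => t At; apply/asboolP => v /=.
  by apply: has_inf_le => //; exists t.
exists p; split=> // p' p'S p'p.
have p'q v : p' v <= q v := le_trans (p'p v) (pq v).
have := pmin (mk p' p'S p'q); rewrite /r /=.
by move=> /(_ (introT (asboolP _) p'p))/(congr1 sval).
Qed.

(* A minimal sublinear [p] is additive: [p] is not larger than its directional
   improvement [v |-> inf (p (v + t *: w) - t * p w)], [0 <= t]. *)
Lemma hahn_banach (q : V -> R) : sublinear q ->
  exists F : {linear V -> R^o}, forall v, F v <= q v.
Proof.
move=> /minimal_sublinear[p [pS pq pmin]]; have [pD pZ] := pS.
have pA v w : p (v + w) = p v + p w.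
  pose P v := [set r | exists2 t, 0 <= t & r = p (v + t *: w) - t * p w].
  have P0 u : P u (p u) by exists 0; rewrite // scale0r mul0r addr0 subr0.
  have Pinf u : has_inf (P u).
    split; first by exists (p u).
    (* Here [t * p w = p (t *: w)], and [t *: w] is the sum of [u + t *: w] and [- u]. *)
    exists (- p (- u)) => _ [t t0 ->]; rewrite lerBrDr.
    rewrite addrC lerBlDr -sublinearZ//.
    by apply: le_trans (pD _ _); rewrite addrAC subrr add0r.
  have iS : sublinear (fun u => inf (P u)).
    apply: inf_sublinear => // [u v' _ _ [s s0 ->] [t t0 ->]|a u _ a0 [t t0 ->]].
      exists (p (u + v' + (s + t) *: w) - (s + t) * p w).
        by exists (s + t); rewrite ?addr_ge0.
      have := pD (u + s *: w) (v' + t *: w).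
      by rewrite addrACA -scalerDl; lra.
    exists (p (a *: u + (a * t) *: w) - (a * t) * p w).
      by exists (a * t); rewrite ?mulr_ge0.
    by have := pZ a (u + t *: w) a0; rewrite scalerDr scalerA; lra.
  have ip u : inf (P u) <= p u by exact: has_inf_le.
  (* By minimality the improvement equals [p]; its member at [t = 1] yields
     [p v + p w <= p (v + w)]. *)
  have /(congr1 (@^~ v)) /= ipv := pmin _ iS ip.
  apply/eqP; rewrite eq_le pD /= -ipv -lerBrDr.
  by apply: has_inf_le => //; exists 1; rewrite // scale1r mul1r.
have p0 : p 0 = 0 by apply: (addrI (p 0)); rewrite -pA !addr0.
have pN v : p (- v) = - p v by apply/eqP; rewrite -subr_eq0 opprK -pA addNr p0.
have plin : linear (p : V -> R^o).
  move=> a u v; rewrite pA; congr (_ + _); have [a0|a0] := leP 0 a.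
    exact: sublinearZ.
  by apply: oppr_inj; rewrite -pN -scaleNr sublinearZ ?mulNr// oppr_ge0 ltW.
pose pL := GRing.isLinear.Build _ _ _ _ (p : V -> R^o) plin.
pose F : {linear V -> R^o} := HB.pack (p : V -> R^o) pL.
by exists F.
Qed.

End HahnBanach.

(** * Convex combinations of points that every slice contains *)

Section ConvexCombinations.
Context (R : realType) (V : normedModType R).
Implicit Types (G : set V) (s : seq (R * V)).

(** A list of pairs (coefficient, vector) encodes an element of the cone over [G]: concatenation is
    addition, and weight 1 marks the convex combinations. *)
Definition positive_in G s : Prop := forall p, p \in s -> 0 <= p.1 /\ G p.2.
Definition weight s : R := \sum_(p <- s) p.1.
Definition combination s : V := \sum_(p <- s) p.1 *: p.2.

Lemma positive_cat G s1 s2 :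
  positive_in G s1 -> positive_in G s2 -> positive_in G (s1 ++ s2).
Proof. by move=> H1 H2 p; rewrite mem_cat => /orP[/H1|/H2]. Qed.

Lemma weight_ge0 G s : positive_in G s -> 0 <= weight s.
Proof.
by move=> Gs; rewrite /weight big_seq sumr_ge0// => p /Gs[].
Qed.

Definition rescale (a : R) s := [seq (a * p.1, p.2) | p <- s].

Lemma positive_rescale G (a : R) s :
  0 <= a -> positive_in G s -> positive_in G (rescale a s).
Proof.
by move=> a0 Gs _ /mapP[p /Gs[p0 Gp] ->]; rewrite /= mulr_ge0.
Qed.

Lemma weight_rescale a s : weight (rescale a s) = a * weight s.
Proof. by rewrite /weight big_map mulr_sumr. Qed.

Lemma combination_rescale a s :
  combination (rescale a s) = a *: combination s.
Proof.
rewrite /combination big_map scaler_sumr.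
by apply: eq_bigr => p _; rewrite scalerA.
Qed.

(* If [u] stays at distance [d] from the convex hull of [G], then
   [inf (|v - c| - d * w)], over the elements [c] of weight [w] of the cone
   generated by [G - u], is sublinear; a linear functional below it is bounded
   by the norm and separates [u] from [G] with a gap [d]. *)
Lemma slices_meet_approx G u : unit_ball u ->
  (forall S, slice V S -> S `&` G !=set0) -> forall d : R, 0 < d ->
  exists s, [/\ positive_in G s, weight s = 1 & `|u - combination s| < d].
Proof.
move=> u1 GS d d0; apply: contrapT => noapx.
(* Dividing by the weight gives a convex combination, so the distance bound extends to the whole
   cone. *)
have far s : positive_in G s ->
    d * weight s <= `|combination s - weight s *: u|.
  move=> Gs; have [->|w0] := eqVneq (weight s) 0; first by rewrite mulr0.
  have wgt0 : 0 < weight s by rewrite lt_neqAle eq_sym w0 (weight_ge0 Gs).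
  rewrite leNgt; apply/negP => lt; apply: noapx.
  exists (rescale (weight s)^-1 s); split.
  - by apply: positive_rescale; rewrite // invr_ge0 ltW.
  - by rewrite weight_rescale mulVf.
  rewrite combination_rescale distrC -[u in _ - u]scale1r -(mulVf w0) -scalerA.
  by rewrite -scalerBr normrZ gtr0_norm ?invr_gt0// mulrC ltr_pdivrMr.
pose P v := [set r | exists2 s, positive_in G s &
  r = `|v - (combination s - weight s *: u)| - d * weight s].
have Gnil : positive_in G [::] by [].
have P0 v : P v `|v|.
  exists [::]; rewrite // /combination /weight !big_nil.
  by rewrite scale0r !subr0 mulr0 subr0.
have Pinf v : has_inf (P v).
  split; first by exists `|v|.
  exists (- `|v|) => _ [s Gs ->]; set c := _ - weight s *: u.
  have := far s Gs; have := ler_normB (v - c) v; rewrite -/c.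
  by rewrite addrAC subrr add0r normrN; lra.
have qS : sublinear (fun v => inf (P v)).
  apply: inf_sublinear => // [v w _ _ [s Gs ->] [t Gt ->]|a v _ a0 [s Gs ->]].
    eexists; first by exists (s ++ t); [exact: positive_cat|].
    rewrite /combination /weight !big_cat /= scalerDl.
    rewrite [leRHS]addrACA -opprD -mulrDr lerD2r.
    apply: le_trans (ler_normD _ _).
    by rewrite (opprD (weight s *: u)) addrACA opprD addrACA.
  eexists; first by exists (rescale a s); [exact: positive_rescale|].
  rewrite combination_rescale weight_rescale -scalerA -!scalerBr normrZ.
  by rewrite ger0_norm// mulrBr mulrCA.
have [F Fq] := hahn_banach qS.
have Fnorm v : F v <= `|v|.
  by apply: le_trans (Fq v) _; exact: has_inf_le.
have FG x : G x -> F x <= F u - d.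
  move=> Gx; suff : F (x - u) <= - d by rewrite linearB /=; lra.
  apply: le_trans (Fq _) _; apply: has_inf_le => //.
  exists [:: (1, x)]; first by move=> p; rewrite inE => /eqP ->.
  by rewrite /combination /weight !big_seq1 !scale1r subrr normr0 mulr1 sub0r.
have Fcont : continuous F.
  apply: bounded_linear_continuous; apply/linear_boundedP.
  near=> r => v; apply: le_trans (_ : `|v| <= _); last first.
    by rewrite ler_peMl//; near: r; apply: nbhs_pinfty_ge; exact: num_real.
  by rewrite ler_norml Fnorm andbT lerNl -linearN -(normrN v) Fnorm.
have supF : has_sup (F @` unit_ball (V := V)).
  split; first by exists (F u), u.
  by exists 1 => _ [x x1 <-]; exact: le_trans (Fnorm x) x1.
(* This width puts the slice above the level [F u - d], which [F] does not exceed on [G]; hence the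
   slice misses [G]. *)
pose a := sup (F @` unit_ball (V := V)) - F u + d.
have Fu : F u <= sup (F @` unit_ball (V := V)).
  by apply: ub_le_sup; [case: supF|exists u].
have [|x [[_ /= Fx] /FG Fxd]] :=
  GS [set x | unit_ball x /\ sup (F @` unit_ball (V := V)) - a < F x].
  by exists F, a; split=> //; split=> //; rewrite /a; lra.
by move: Fx; rewrite /a; lra.
Unshelve. all: by end_near. Qed.

End ConvexCombinations.

(** * Comparison of cardinals *)

Lemma inj_on_card_le (T U : Type) (f : T -> U) (A : set T) (B : set U) :
  (forall x, A x -> B (f x)) -> (forall x y, A x -> A y -> f x = f y -> x = y) ->
  A #<= B.
Proof.
move=> fAB finj; suff /injfunPex[g] : exists2 f, set_fun A B f & set_inj A f.
  exact: inj_card_le.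
by exists f => // x y /set_mem Ax /set_mem Ay; exact: finj.
Qed.

(* Zorn gives a maximal set [S] of choice functions [g], [g A \in A], that any
   two of which differ at every member of [F]; by maximality [S] maps onto some
   member of [F], and it injects into all the others. *)
Lemma card_le_minimum (T : Type) (F : set (set T)) : F !=set0 ->
  exists2 A, F A & forall B, F B -> A #<= B.
Proof.
move=> [A0 FA0]; pose P (S : set (set T -> T)) :=
  (forall g A, S g -> F A -> A (g A)) /\
  (forall g h A, S g -> S h -> F A -> g A = h A -> g = h).
have [|S [[SA Sinj] Smax]] := @Zorn_bigcup _ P.
  move=> C CP Ctot; split.
    by move=> g A [S CS Sg] FA; have [SA _] := CP _ CS; exact: (SA _ _ Sg FA).
  move=> g h A [S CS Sg] [S' CS' Sh] FA.
  have [_ Si] := CP _ CS; have [_ S'i] := CP _ CS'.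
  by have [/(_ _ Sg)|/(_ _ Sh)] := Ctot _ _ CS CS' => ? gh;
    [exact: (S'i _ _ A)|exact: (Si _ _ A)].
have [A FA SontoA] : exists2 A, F A & A `<=` [set g A | g in S].
  apply: contrapT => notonto.
  have out A : exists x, F A -> A x /\ forall g, S g -> g A <> x.
    (* Outside [F] any default value will do; [A0] has one, since an empty [A0] would be trivially
       covered. *)
    have [FA|nFA] := pselect (F A); last first.
      have [t _] : A0 !=set0; last by exists t.
      apply: contrapT => A00; apply: notonto; exists A0 => // t A0t.
      by exfalso; apply: A00; exists t.
    apply: contrapT => noout; apply: notonto; exists A => // x Ax.
    apply: contrapT => nx; apply: noout; exists x => _; split=> // g Sg gx.
    by apply: nx; exists g.
  have [g gP] := choice out.
  have nSg : ~ S g by move=> Sg; have [_ /(_ g Sg)] := gP _ FA0.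
  apply: (Smax (S `|` [set g])).
    by split; [move=> h Sh; left|move=> sub; apply/nSg/sub; right].
  split; first by move=> h A [Sh|->] FA; [exact: (SA _ _ Sh FA)|by have [] := gP A FA].
  move=> h k A [Sh|->] [Sk|->] FA //; first exact: (Sinj _ _ A).
    by move=> hg; have [_ /(_ h Sh)] := gP A FA.
  by move=> hg; have [_ /(_ k Sk)] := gP A FA; rewrite hg.
exists A => // B FB.
apply: card_le_trans (subset_card_le SontoA) _.
apply: card_le_trans (card_image_le _ _) _.
apply: (inj_on_card_le (f := fun g => g B)) => [g Sg|g h Sg Sh];
  first exact: (SA _ _ Sg FB).
exact: (Sinj _ _ B).
Qed.

(** Hilbert's hotel: [A] contains a copy [i] of the naturals. The map [h] sends its first [size s]
    terms onto [B], shifts the later ones back and fixes everything else, so it maps [A] onto the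
    union. *)
Lemma infinite_setU_finite_card_le (T : pointedType) (A B : set T) :
  infinite_set A -> finite_set B -> A `|` B #<= A.
Proof.
move=> /infiniteP/pcard_leP[i] /finite_seqP[s ->].
have iinj : injective i by move=> m n; apply: inj; exact: in_setT.
(* The default of [nth] is the shifted term, reached exactly when the index is at least [size s]. *)
pose h x := if pselect (exists k, x = i k) is left e
  then nth (i (sval (cid e) - size s)%N) s (sval (cid e)) else x.
have hi k : h (i k) = nth (i (k - size s)%N) s k.
  rewrite /h; case: pselect => [e|[]]; last by exists k.
  by case: cid => /= n /iinj ->.
have onto : A `|` [set` s] `<=` h @` A.
  move=> x [Ax|/= xs]; last first.
    exists (i (index x s)); first exact: funS.
    by rewrite hi nth_index.
  have [[k ->]|nx] := pselect (exists k, x = i k); last first.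
    by exists x => //; rewrite /h; case: pselect.
  exists (i (k + size s)%N); first exact: funS.
  by rewrite hi nth_default ?leq_addl// addnK.
exact: card_le_trans (subset_card_le onto) (card_image_le _ _).
Qed.

(** * Spans and their density character *)

Section Span.
Context (R : realType) (V : normedModType R) (D : set V).

Definition span_pred : {pred V} := [pred v | `[< lin_span D v >]].

Lemma span_submod_closed : submod_closed span_pred.
Proof.
split.
  apply/asboolP; exists 0%N, (fun=> 0), (fun=> 0).
  by split=> [[]|] //; rewrite big_ord0.
move=> c u v /asboolP[m [a [x [Dx ->]]]] /asboolP[n [b [y [Dy ->]]]].
apply/asboolP; exists (m + n)%N.
exists (fun i => match fintype.split i with inl j => c * a j | inr j => b j end).
exists (fun i => match fintype.split i with inl j => x j | inr j => y j end).
split=> [i|]; first by case: (fintype.split i).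
rewrite big_split_ord /= scaler_sumr; congr (_ + _); apply: eq_bigr => i _.
  by rewrite (unsplitK (inl i)) scalerA.
by rewrite (unsplitK (inr i)).
Qed.

HB.instance Definition _ :=
  GRing.isSubmodClosed.Build R V span_pred span_submod_closed.

Definition span : submodClosed V := span_pred.

Lemma mem_span v : D v -> v \in span.
Proof.
move=> Dv; apply/asboolP; exists 1%N, (fun=> 1), (fun=> v).
by split=> //; rewrite big_ord1 scale1r.
Qed.

Lemma lin_span_span : lin_span (\val @^-1` D : set (submod span)) = setT.
Proof.
apply/seteqP; split=> // v _; have /asboolP[n [a [x [Dx vE]]]] : \val v \in span := submodP v.
exists n, a, (fun i => Submod (mem_span (Dx i))); split=> //.
by apply: val_inj; rewrite [RHS]raddf_sum vE; apply: eq_bigr => i _; rewrite [RHS]linearZ.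
Qed.

(** A least set with dense span exists by [card_le_minimum] and is no larger than [D]. If [A] is
    finite, so is [D], while [K] is infinite; otherwise [A] absorbs the finite rest of [D], and [K']
    bounds the result. *)
Lemma dens_span_lt (K K' : Type) (A : set V) :
  card_lt [set: K'] [set: K] -> infinite_set [set: K] ->
  A #<= [set: K'] -> finite_set (D `\` A) -> dens_lt (submod span) K.
Proof.
move=> [K'K KK'] Kinf AK' Dfin.
have [|B densB Bmin] := @card_le_minimum (submod span) [set B | dense (lin_span B)].
  exists (\val @^-1` D) => /=; rewrite lin_span_span => O [x Ox] _.
  by exists x.
have BD : B #<= D.
  apply: card_le_trans (_ : _ #<= \val @^-1` D) _.
    apply: Bmin => /=; rewrite lin_span_span => O [x Ox] _.
    by exists x.
  by apply: (inj_on_card_le (f := \val)) => // x y _ _; exact: val_inj.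
have {}BD : B #<= A `|` (D `\` A).
  apply: card_le_trans BD (subset_card_le _) => x Dx.
  by have [Ax|nAx] := pselect (A x); [left|right].
exists B; split; first by split.
have [Afin|Ainf] := pselect (finite_set A).
  have Bfin : finite_set B.
    by apply: card_le_finite BD _; rewrite finite_setU.
  split; last by move=> /card_le_finite /(_ Bfin).
  by apply: card_le_trans (finite_set_countable Bfin) _; exact/infiniteP.
have {}BD : B #<= [set: K'].
  apply: card_le_trans BD _; apply: card_le_trans AK'.
  exact: infinite_setU_finite_card_le.
split; first exact: card_le_trans BD K'K.
by move=> KB; apply: KK'; exact: card_le_trans KB BD.
Qed.

End Span.

(** * Transfer of slice points through an ideal operator *)

Section Ideals.
Context (R : realType) (X : normedModType R).

Lemma weighted_mean_lt (G : set X) (s : seq (R * X)) (phi : X -> R) (c : R) :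
  positive_in G s -> weight s = 1 -> c < \sum_(p <- s) p.1 * phi p.2 ->
  exists x, [/\ x \in [seq p.2 | p <- s], G x & c < phi x].
Proof.
move=> Gs s1 clt; apply: contrapT => no; move: clt; apply/negP; rewrite -leNgt.
rewrite -[c]mul1r -s1 /weight mulr_suml !big_seq; apply: ler_sum => p ps.
have [p0 Gp] := Gs _ ps; rewrite ler_wpM2l// leNgt; apply/negP => cp.
by apply: no; exists p.2; split=> //; exact: map_f.
Qed.

(** Common core of both statements: [eta = 0] serves isometries, [eta > 0] almost isometries. Since
    [eta0] depends on the slice alone, [eta] can still be shrunk afterwards. *)
Lemma ideal_slice (Y : submodClosed X) (K K' : Type) (S : set (submod Y)) :
  card_lt [set: K'] [set: K] -> infinite_set [set: K] -> slice (submod Y) S ->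
  exists2 eta0 : R, 0 < eta0 & forall eta, 0 <= eta <= eta0 ->
  (forall E : submodClosed X, dens_lt (submod E) K ->
    exists T : {linear submod E -> submod Y},
      (forall e, (1 - eta) * `|e| <= `|T e| <= (1 + eta) * `|e|) /\
      (forall e, \val e \in Y -> \val (T e) = \val e)) ->
  forall (A : set (submod Y)) (G : set X), A #<= [set: K'] ->
  G `<=` @unit_ball _ X -> (forall S', slice X S' -> S' `&` G !=set0) ->
  exists x w, [/\ G x, `|w| <= 1 + eta, S ((1 + eta)^-1 *: w) &
    forall y, A y ->
      (1 - eta) * `|\val y + x| <= `|y + w| <= (1 + eta) * `|\val y + x|].
Proof.
move=> KK Kinf [f [a [fc [a0 ->]]]].
have [M M0 fM] : exists2 M, 0 < M & forall x, `|f x| <= M * `|x|.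
  have /linear_boundedP fM : bounded_near f (nbhs 0).
    exact/linear_bounded_continuous.
  near (+oo_R : set_system R) => M; exists M; last by near: M.
  by near: M; exact: nbhs_pinfty_gt.
pose sf := sup (f @` unit_ball (V := submod Y)).
have fsup : has_sup (f @` unit_ball (V := submod Y)).
  split; first by exists (f 0), 0; rewrite // /unit_ball /= normr0.
  exists M => _ [x x1 <-]; apply: le_trans (ler_norm _) _.
  by apply: le_trans (fM x) _; rewrite ler_piMr// ltW.
have [_ [u u1 <-]] := sup_adherent (divr_gt0 a0 (ltr0n _ 2)) fsup.
rewrite -/sf => fu.
(* The quantity [M * d = a / 4] is spent twice: on the distance from [u] to a convex combination,
   and on [M * eta], the loss from rescaling by [(1 + eta)^-1]. *)
pose d := a / (4 * M); have d0 : 0 < d by rewrite divr_gt0// mulr_gt0.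
have Md : M * d = a / 4 by rewrite /d; field; rewrite gt_eqF.
exists d => // eta /andP[eta0 etad] ideal A G AK' G1 Gslice.
have [s [Gs s1 us]] := slices_meet_approx (u := \val u) u1 Gslice d0.
pose AX : set X := [set \val y | y in A].
pose D : set X := AX `|` ([set \val u] `|` [set` [seq p.2 | p <- s]]).
have densE : dens_lt (submod (span D)) K.
  apply: (dens_span_lt (A := AX) KK Kinf).
    exact: card_le_trans (card_image_le _ _) AK'.
  apply: (@sub_finite_set _ _ ([set \val u] `|` [set` [seq p.2 | p <- s]])).
    by move=> x [[]].
  by rewrite finite_setU; split; [exact: finite_set1|exact: finite_seq].
have [T [Tnorm Tfix]] := ideal _ densE.
pose L x : submod (span D) := insubd 0 x.
have LK x : D x -> \val (L x) = x by move=> Dx; apply/insubdK/mem_span.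
have TY (y : submod Y) : D (\val y) -> T (L (\val y)) = y.
  move=> Dy; apply: val_inj; rewrite Tfix LK//; exact: submodP.
have Du : D (\val u) by right; left.
have Ds x : x \in [seq p.2 | p <- s] -> D x by move=> xs; right; right.
pose v := \sum_(p <- s) p.1 *: L p.2.
have vE : \val v = combination s.
  rewrite raddf_sum /combination !big_seq; apply: eq_bigr => p ps.
  by rewrite [LHS]linearZ; congr (_ *: _); apply: LK; apply/Ds/map_f.
(* As [T] fixes [u], this is the norm of the image of [u - v]. *)
have Tuv : `|u - T v| <= (1 + eta) * d.
  rewrite -{1}(TY u)// -linearB; have /andP[_ /le_trans] := Tnorm (L (\val u) - v).
  apply; rewrite ler_wpM2l ?addr_ge0// ltW//.
  suff -> : `|L (\val u) - v| = `|\val u - combination s| by [].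
  by rewrite -vE -{2}(LK _ Du) -raddfB.
have fTv : f (T v) = \sum_(p <- s) p.1 * f (T (L p.2)).
  by rewrite !linear_sum; apply: eq_bigr => p _; rewrite !linearZ.
have := fM (u - T v); rewrite linearB /= => /ler_normlW fuTv.
have fuM : f u <= M.
  apply: le_trans (ler_norm _) _; apply: le_trans (fM u) _.
  by rewrite ler_piMr// ltW.
(* The threshold carries the factor [1 + eta] because [T (L x)] will be divided by it to return to
   the unit ball. *)
have [|x [xs Gx fx]] :=
    weighted_mean_lt (phi := fun x => f (T (L x)))
      (c := (1 + eta) * (sf - a)) Gs s1.
  rewrite -fTv.
  have : M * `|u - T v| <= M * ((1 + eta) * d) by rewrite ler_wpM2l// ltW.
  have : M * eta <= M * d by rewrite ler_wpM2l// ltW.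
  nra.
have eta1 : 0 < 1 + eta by rewrite ltr_pwDl.
have x1 : `|T (L x)| <= 1 + eta.
  have /andP[_ /le_trans] := Tnorm (L x); apply.
  rewrite ler_piMr//; first exact: ltW.
  suff -> : `|L x| = `|x| by exact: G1.
  by rewrite -[in RHS](LK _ (Ds _ xs)).
exists x, (T (L x)); split=> //.
  split; last by rewrite linearZ /= -/sf ltr_pdivlMl.
  by rewrite /unit_ball /= normrZ gtr0_norm ?invr_gt0// ler_pdivrMl// mulr1.
move=> y Ay; have Dy : D (\val y) by left; exists y.
have := Tnorm (L (\val y) + L x); rewrite linearD TY//.
suff -> : `|L (\val y) + L x| = `|\val y + x| by [].
by rewrite -[in RHS](LK _ (Ds _ xs)) -[in RHS](LK _ Dy) -raddfD.
Unshelve. all: by end_near. Qed.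

End Ideals.

(** * Inheritance of both Daugavet properties *)

Theorem proposition8p2 (R : realType) (X : completeNormedModType R)
    (Y : submodClosed X) (K K' : Type) :
  card_lt [set: K'] [set: K] ->
  infinite_set [set: K] ->
  (Daugavet X K' -> almost_isometric_ideal K Y -> Daugavet (submod Y) K') /\
  (perfect_Daugavet X K' -> isometric_ideal K Y ->
     perfect_Daugavet (submod Y) K').
Proof.
move=> KK Kinf.
have cardX (A : set (submod Y)) : A #<= [set: K'] ->
    [set \val y | y in A] #<= [set: K'].
  by apply: card_le_trans; exact: card_image_le.
have sphereX (A : set (submod Y)) : A `<=` @unit_sphere _ _ ->
    [set \val y | y in A] `<=` @unit_sphere _ X.
  by move=> A1 _ [y /A1 y1 <-].
split=> dauX idealY A A1 AK' S Sslice.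
  move=> eps eps0; have [eta0 eta00 slc] := ideal_slice KK Kinf Sslice.
  (* Normalizing [w] costs at most [eta], and [(1 - eta) * (2 - eta)] falls short of 2 by less than
     [3 * eta]; together this stays below [eps]. The bound 1 keeps [1 - eta] nonnegative. *)
  pose eta := Num.min eta0 (Num.min (eps / 4) 1).
  have eta_gt0 : 0 < eta by rewrite !lt_min eta00 ltr01 divr_gt0.
  have [eta_eta0 eta_eps eta1] : [/\ eta <= eta0, eta <= eps / 4 & eta <= 1].
    by rewrite /eta !ge_min !lexx ?orbT.
  pose G : set X := [set x | `|x| <= 1 /\
    forall y, A y -> 2 - eta < `|\val y + x|].
  have [||||x [w [[_ Gx] w1 Sw Aw]]] := slc eta _ _ A G AK'.
  - by rewrite (ltW eta_gt0).
  - by move=> E dE; exact: idealY.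
  - by move=> x [].
  - move=> S' S'slice; have [x S'x xA] :=
      dauX _ (sphereX A A1) (cardX A AK') S' S'slice _ eta_gt0.
    exists x; split=> //; split; last by move=> y Ay; apply: xA; exists y.
    by case: S'slice => f [a [_ [_ S'E]]]; move: S'x; rewrite S'E => -[].
  exists ((1 + eta)^-1 *: w) => // y Ay; have /andP[yw _] := Aw y Ay.
  have eta10 : 0 < 1 + eta by lra.
  have ww : `|w - (1 + eta)^-1 *: w| <= eta.
    have -> : w - (1 + eta)^-1 *: w = (1 - (1 + eta)^-1) *: w.
      by rewrite scalerBl scale1r.
    rewrite normrZ.
    have -> : 1 - (1 + eta)^-1 = eta / (1 + eta) by field; rewrite gt_eqF.
    rewrite gtr0_norm ?divr_gt0// mulrAC ler_pdivrMr// ler_wpM2l//; exact: ltW.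
  have : `|y + w| <= `|y + (1 + eta)^-1 *: w| + `|w - (1 + eta)^-1 *: w|.
    by apply: le_trans (ler_normD _ _); rewrite addrACA subrr addr0.
  have := Gx y Ay.
  nra.
have [eta0 eta00 slc] := ideal_slice KK Kinf Sslice.
pose G : set X := [set x | `|x| <= 1 /\ forall y, A y -> `|\val y + x| = 2].
(* At [eta = 0] the two norm bounds coincide and force the value 2 exactly. *)
have [||||x [w [[_ Gx] w1 Sw Aw]]] := slc 0 _ _ A G AK'.
- by rewrite lexx ltW.
- move=> E /idealY[T [Tnorm Tfix]]; exists T; split=> // e.
  by rewrite subr0 addr0 mul1r Tnorm lexx.
- by move=> x [].
- move=> S' S'slice; have [x S'x xA] :=
      dauX _ (sphereX A A1) (cardX A AK') S' S'slice.
  exists x; split=> //; split; last by move=> y Ay; apply: xA; exists y.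
  by case: S'slice => f [a [_ [_ S'E]]]; move: S'x; rewrite S'E => -[].
exists w => [|y Ay]; first by move: Sw; rewrite addr0 invr1 scale1r.
by have := Aw y Ay; rewrite Gx// subr0 addr0 mul1r => /le_anti.
Qed.
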